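(* Let $A$ be a $1 \times n$ real matrix, let $\sigma:\mathbb{R}\to\mathbb{R}$ be a weakly monotone continuous function and let $f=\sigma \circ A : \mathbb{R}^n \to \mathbb{R}$, $x \mapsto \sigma(Ax)$. Assume that $\sigma$ is a continuous piecewise function built by gluing $k$ linear functions, namely that $$\sigma(x) = \begin{cases} m_1 x + q_1 & \text{if } x < a_1,\\ m_2 x + q_2 & \text{if } a_1 \leq x < a_2,\\ \quad\vdots\\ m_{k-1} x + q_{k-1} & \text{if } a_{k-2} \leq x < a_{k-1},\\ m_k x + q_k & \text{if } x \geq a_{k-1}, \end{cases}$$ where $a_1<\dots<a_{k-1}$ are real numbers, $m_i,q_i \in \mathbb{R}$, $m_i \neq m_{i+1}$ for every $i=1,\ldots,k-1$, and $\lim_{x\rightarrow a_i^-}\sigma(x) = \sigma(a_i)$ for every $i=1,\ldots,k-1$. Let $\gamma:[c,d]\rightarrow\mathbb{R}^n$ be a null curve such that $f'(\gamma(s))$ (the differential of $f$ at $\gamma(s)$, in particular assumed to exist) is constant for all $s \in [c,d]$. Then two points $p,q$ belonging to different equivalence classes of $f$ cannot both belong to $\mathrm{Im}(\gamma)$.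
   Context: The equivalence classes of $f$ are those of the relation on $\mathbb{R}^n$ defined by $p \sim q$ if and only if $f(p)=f(q)$. Weakly monotone means non-decreasing or non-increasing. With $g$ the standard metric on $\mathbb{R}$, the pullback $f^*g$ is defined at the points $x$ where $f$ is differentiable, and is the bilinear form with matrix $(f^*g)_{ij}(x) = \frac{\partial f}{\partial x_i}(x)\,\frac{\partial f}{\partial x_j}(x)$. A null curve is a piecewise $\mathcal{C}^1$ curve $\gamma:[c,d]\to\mathbb{R}^n$ such that $\dot\gamma(s) \in \mathrm{Ker}\big((f^*g)_{\gamma(s)}\big)$ for every $s$ (other than the finitely many break points of $\gamma$) at which $f^*g$ is defined at $\gamma(s)$. *)

(* Defs.v *)
From HB Require Import structures.
From mathcomp Require Import all_boot all_order all_algebra.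
From mathcomp Require Import all_classical all_reals all_analysis.

Set Implicit Arguments.
Unset Strict Implicit.
Unset Printing Implicit Defensive.

Import Order.TTheory GRing.Theory Num.Theory.
Import numFieldNormedType.Exports.

Local Open Scope classical_set_scope.
Local Open Scope ring_scope.

Definition weakly_monotone (R : realType) (sigma : R -> R) : Prop :=
  {homo sigma : x y / x <= y} \/ {homo sigma : x y / x <= y >-> y <= x}.

(* Indices start at 1: the slopes and intercepts are m 1, ..., m k and
   q 1, ..., q k, the nodes are a 1 < ... < a (k - 1), and the values of m, q
   and a at other indices are irrelevant. Piece i is the interval
   [a (i - 1), a i[, where the lower bound is absent for i = 1 and the upper
   bound is absent for i = k. *)
Definition piecewise_linear (R : realType) (k : nat) (a m q : nat -> R)
    (sigma : R -> R) : Prop :=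
  [/\ (0 < k)%N,
      (forall i, (1 <= i)%N -> (i.+1 < k)%N -> a i < a i.+1),
      (forall i, (1 <= i <= k)%N -> forall x : R,
         ((1 < i)%N -> a i.-1 <= x) -> ((i < k)%N -> x < a i) ->
         sigma x = m i * x + q i),
      (forall i, (1 <= i < k)%N -> m i != m i.+1) &
      (forall i, (1 <= i < k)%N ->
         sigma x @[x --> (a i)^'-] --> sigma (a i))].

Definition eqv_class (T U : Type) (f : T -> U) (p : T) : set T :=
  [set q | f p = f q].

Section PullbackMetric.
Context {R : realType} {n : nat}.
Implicit Types (f : 'cV[R]_n -> R) (x v w : 'cV[R]_n).

Definition partial f (i : 'I_n) x : R := 'D_(delta_mx i 0) f x.

(* The pullback is only defined where f is differentiable; the total functions
   below are to be used under that hypothesis. *)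
Definition pullback_mx f x : 'M[R]_n :=
  \matrix_(i, j) (partial f i x * partial f j x).

Definition pullback_form f x v w : R := (v^T *m pullback_mx f x *m w) 0 0.

Definition pullback_ker f x : set 'cV[R]_n :=
  [set v | forall w, pullback_form f x v w = 0].

End PullbackMetric.

Section Curves.
Context {R : realType} {n : nat}.
Implicit Types (gamma : R -> 'cV[R]_n) (a b c d : R) (bs : seq R).

(* v is the derivative at s of the restriction of gamma to D: one-sided at an
   endpoint of an interval D, two-sided in its interior. *)
Definition has_velocity (D : set R) gamma (s : R) (v : 'cV[R]_n) : Prop :=
  (t - s)^-1 *: (gamma t - gamma s) @[t --> within D s^'] --> v.

Definition C1_on a b gamma : Prop :=
  exists2 gamma' : R -> 'cV[R]_n,
    (forall s, s \in `[a, b] -> has_velocity `[a, b] gamma s (gamma' s)) &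
    {within `[a, b], continuous gamma'}.

(* bs lists the break points; being C^1 on each piece of the subdivision of
   [c, d] by bs amounts to being C^1 on every nondegenerate closed subinterval
   with no break point in its interior. *)
Definition piecewise_C1 c d bs gamma : Prop :=
  [/\ {within `[c, d], continuous gamma},
      (forall t, t \in bs -> c < t < d) &
      (forall a b, c <= a -> a < b -> b <= d ->
         (forall t, t \in bs -> ~~ (a < t < b)) -> C1_on a b gamma)].

Definition null_curve (f : 'cV[R]_n -> R) c d gamma : Prop :=
  exists2 bs : seq R, piecewise_C1 c d bs gamma &
    forall s, s \in `[c, d] -> s \notin bs -> differentiable f (gamma s) ->
      exists2 v, has_velocity `[c, d] gamma s v & pullback_ker f (gamma s) v.

End Curves.

(* Main.v *)
Require Import Defs.
From HB Require Import structures.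
From mathcomp Require Import all_boot all_order all_algebra.
From mathcomp Require Import all_classical all_reals all_analysis.
From mathcomp Require Import ring.

Set Implicit Arguments.
Unset Strict Implicit.
Unset Printing Implicit Defensive.

Import Order.TTheory GRing.Theory Num.Theory.
Import numFieldNormedType.Exports.

Local Open Scope classical_set_scope.
Local Open Scope ring_scope.

(** Null curves are tangent to the level sets of [f], so [f] cannot change its
    value along a curve whose points are all points of differentiability.

    The pullback of the metric of the line by [f] has rank at most one: on the
    diagonal, [f^*g (v, v)] is the square of [df v] ([pullback_form_diag]).
    Hence its kernel is contained in that of [df], and by the chain rule
    [f \o gamma] has derivative zero at every interior parameter which is not a
    break point of [gamma]. As [f \o gamma] is continuous and the break points
    are finite in number, the mean value theorem between consecutive break
    points makes it constant ([derive0_off_seq_cst], [null_curve_cst]). Two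
    points of the image of [gamma] are therefore always in the same class. *)

(** Away from the endpoints the velocity relative to [[c, d]] is a two-sided
    derivative, which is what the chain rule needs. *)
Lemma velocity_is_derive (R : realType) (n : nat) (gamma : R -> 'cV[R]_n)
    (c d s : R) (v : 'cV[R]_n) :
  s \in `]c, d[ -> has_velocity `[c, d] gamma s v -> is_derive s 1 gamma v.
Proof.
move=> sI velo.
have quot : h^-1 *: (gamma (h *: 1 + s) - gamma s) @[h --> 0^'] --> v.
  move=> P Pv.
  have near_s : \forall t \near s, t != s ->
      P ((t - s)^-1 *: (gamma t - gamma s)).
    have : \forall t \near s, t != s -> `[c, d]%classic t ->
        P ((t - s)^-1 *: (gamma t - gamma s)) by exact: (velo P Pv).
    move=> velo'; near=> t => ts.
    suff tI : `[c, d]%classic t by move: ts tI; near: t.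
    apply: subset_itv_oo_cc; near: t; exact: near_in_itvoo sI.
  have shift_s : h + s @[h --> (0 : R)] --> s.
    by rewrite -[X in _ --> X]add0r; apply: cvgD => //; exact: cvg_cst.
  have := shift_s _ near_s; rewrite !near_simpl => near_0.
  apply: (filterS _ near_0) => h Ph h0.
  have := Ph; rewrite addrK -subr_eq0 addrK => /(_ h0).
  by rewrite /GRing.scale /= mulr1.
by split; [apply/cvg_ex; exists v|exact/cvg_lim].
Unshelve. all: by end_near. Qed.

Lemma diff_partial (R : realType) (n : nat) (f : 'cV[R]_n -> R)
    (x v : 'cV[R]_n) :
  differentiable f x -> 'd f x v = \sum_i v i 0 * partial f i x.
Proof.
move=> df; rewrite {1}[v]matrix_sum_delta linear_sum; apply: eq_bigr => i _.
by rewrite big_ord1 linearZ /partial deriveE.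
Qed.

(** The matrix of the pullback is the product of the gradient with its
    transpose, so both sides are the same double sum over pairs of
    coordinates. *)
Lemma pullback_form_diag (R : realType) (n : nat) (f : 'cV[R]_n -> R)
    (x v : 'cV[R]_n) :
  differentiable f x -> pullback_form f x v v = 'd f x v ^+ 2.
Proof.
move=> df; rewrite diff_partial// expr2 big_distrlr /pullback_form mxE.
apply: eq_bigr => j _; rewrite mxE mulr_suml; apply: eq_bigr => i _.
by rewrite !mxE /=; ring.
Qed.

Lemma diff_pullback_ker (R : realType) (n : nat) (f : 'cV[R]_n -> R)
    (x v : 'cV[R]_n) :
  differentiable f x -> pullback_ker f x v -> 'd f x v = 0.
Proof.
by move=> df /(_ v); rewrite pullback_form_diag// => /eqP/[!sqrf_eq0]/eqP.
Qed.

(** Induction on the exceptional points: if the first one lies inside the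
    interval, cutting there moves it to an endpoint of both halves, where
    continuity is enough; the mean value theorem settles the case without
    exceptional points. *)
Lemma derive0_off_seq_cst (R : realType) (g : R -> R) (bs : seq R) (x y : R) :
  x <= y -> {within `[x, y], continuous g} ->
  (forall s, s \in `]x, y[ -> s \notin bs -> is_derive s 1 g 0) ->
  g x = g y.
Proof.
elim: bs x y => [|b bs IH] x y.
  rewrite le_eqVlt => /predU1P[->//|xy] gc g0.
  have [s sI|s _] := MVT (df := fun=> 0) xy _ gc; first exact: g0.
  by rewrite mul0r => /eqP; rewrite subr_eq0 => /eqP.
move=> xy gc g0.
have [/andP[xb b_y]|bI] := boolP (x < b < y); last first.
  apply: IH => // s sI sbs; apply: g0 => //.
  rewrite inE negb_or sbs andbT; apply: contraNneq bI => <-.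
  by move: sI; rewrite in_itv.
have gcl : {within `[x, b], continuous g}.
  by apply: continuous_subspaceW gc; apply: subset_itvl; rewrite bnd_simp ltW.
have gcr : {within `[b, y], continuous g}.
  by apply: continuous_subspaceW gc; apply: subset_itvr; rewrite bnd_simp ltW.
have g0l s : s \in `]x, b[ -> s \notin bs -> is_derive s 1 g 0.
  rewrite in_itv /= => /andP[xs sb] sbs; apply: g0.
    by rewrite in_itv /= xs (lt_trans sb).
  by rewrite inE negb_or sbs lt_eqF.
have g0r s : s \in `]b, y[ -> s \notin bs -> is_derive s 1 g 0.
  rewrite in_itv /= => /andP[b_s sy] sbs; apply: g0.
    by rewrite in_itv /= sy (lt_trans xb).
  by rewrite inE negb_or sbs gt_eqF.
exact: etrans (IH x b (ltW xb) gcl g0l) (IH b y (ltW b_y) gcr g0r).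
Qed.

Lemma null_curve_cst (R : realType) (n : nat) (f : 'cV[R]_n -> R)
    (gamma : R -> 'cV[R]_n) (c d : R) :
  null_curve f c d gamma ->
  (forall s, s \in `[c, d] -> differentiable f (gamma s)) ->
  {in `[c, d] &, forall s t, f (gamma s) = f (gamma t)}.
Proof.
move=> [bs [gc _ _] ker] df.
have fgc : {within `[c, d], continuous (f \o gamma)}.
  apply/subspace_continuousP => s sI; apply: cvg_comp.
    exact: (iffLR (subspace_continuousP _ _) gc).
  exact: differentiable_continuous (df s sI).
have fg0 s : s \in `]c, d[ -> s \notin bs -> is_derive s 1 (f \o gamma) 0.
  move=> sI sbs; have sI' := subset_itv_oo_cc sI.
  have [v velo kerv] := ker s sI' sbs (df s sI').
  have [gder gv] := velocity_is_derive sI velo.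
  have gdiff : differentiable gamma s by exact/derivable1_diffP.
  have fdiff := df s sI'.
  have fgdiff := differentiable_comp gdiff fdiff.
  split; first exact/derivable1_diffP.
  (* d(f o gamma)_s 1 = df (gamma' s), and gamma' s = v lies in the kernel *)
  rewrite deriveE// diff_comp//= -(deriveE _ gdiff) gv.
  exact: diff_pullback_ker.
have cst t : t \in `[c, d] -> f (gamma c) = f (gamma t).
  rewrite in_itv /= => /andP[ct td].
  have fgct : {within `[c, t], continuous (f \o gamma)}.
    by apply: continuous_subspaceW fgc; apply: subset_itvl; rewrite bnd_simp.
  have fg0t s : s \in `]c, t[ -> s \notin bs -> is_derive s 1 (f \o gamma) 0.
    rewrite in_itv /= => /andP[cs st]; apply: fg0.
    by rewrite in_itv /= cs (lt_le_trans st).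
  exact: derive0_off_seq_cst ct fgct fg0t.
by move=> s t sI tI; rewrite -cst// -cst.
Qed.

Theorem proposition5 (R : realType) (n : nat) (A : 'M[R]_(1, n))
    (sigma : R -> R) (k : nat) (a m q : nat -> R) :
  let f : 'cV[R]_n -> R := fun x => sigma ((A *m x) 0 0) in
  continuous sigma ->
  weakly_monotone sigma ->
  piecewise_linear k a m q sigma ->
  forall (c d : R) (gamma : R -> 'cV[R]_n),
  c <= d ->
  null_curve f c d gamma ->
  (forall s, s \in `[c, d] -> differentiable f (gamma s)) ->
  (forall s t, s \in `[c, d] -> t \in `[c, d] ->
     'd f (gamma s) = 'd f (gamma t) :> ('cV[R]_n -> R)) ->
  forall p p' : 'cV[R]_n,
  eqv_class f p <> eqv_class f p' ->
  ~ ((gamma @` `[c, d]) p /\ (gamma @` `[c, d]) p').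
Proof.
move=> f _ _ _ c d gamma _ null df _ p p' cls [[s sI ps] [t tI pt]].
by apply: cls; rewrite -ps -pt /eqv_class (null_curve_cst null df sI tI).
Qed.
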